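(* Let $q\ge 3$ and $m\ge 3$ be integers, and let $p_1,\dots,p_m$ and $r_1,\dots,r_m$ be integers with $0<p_k<q$ for $1\le k\le m$. Suppose that (i) $q$ is odd, and $m$ is the order of $2$ modulo $q$; (ii) after renumbering the pairs $(p_k,r_k)$ if necessary, there are integers $\delta$ (relatively prime to $q$, with inverse $\bar\delta$ modulo $q$) and $\gamma$ such that for $1\le k\le m$ $$p_k\equiv \delta\,2^{m-k}\pmod q\quad\text{and}\quad r_k\equiv \gamma-\bar\delta\,2^{k-1}\pmod q .$$ Then the $m$ sequences $\mathcal B_{p_k,r_k}^q$ ($1\le k\le m$) are a perfect $c$-fold covering of $\mathbb Z$, where $c$ is the number of ones in the binary expansion of $\delta(2^m-1)/q$.
   Context: For integers $p,q$ (with $p\neq 0$) and $r$, $\mathcal B_{p,r}^q:=\{\lfloor nq/p+r\rfloor : n\in\mathbb Z\}$ (a rational Beatty set). Sets $S_1,\dots,S_m$ are a perfect $c$-fold covering of $\mathbb Z$ if $S_1(x)+\dots+S_m(x)=c$ for all $x\in\mathbb Z$, where $S_k(x)$ denotes the indicator function of $S_k$ (the multiplicity of $x$ in $S_k$).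
   Formalization: In the definition of c, δ is replaced by its least nonnegative residue modulo q, since for other representatives the claim fails (q=7, m=3, δ=9 gives 9=1001 in binary, two ones, but the covering is 1-fold) or the binary expansion is undefined (δ negative). *)

(* Defs.v *)
From mathcomp Require Import all_boot all_order all_fingroup all_algebra.
From mathcomp Require Import boolp classical_sets.

Set Implicit Arguments.
Unset Strict Implicit.
Unset Printing Implicit Defensive.

Import Order.TTheory GRing.Theory Num.Theory.

Local Open Scope ring_scope.

(* The rational Beatty set {floor (n q / p + r) : n in Z}, meant for p != 0
   (for p = 0 the convention x / 0 = 0 makes it {r}). *)
Definition beatty (q p r : int) : set int :=
  range (fun n : int => Num.floor ((n * q)%:~R / p%:~R + r%:~R : rat)).

Definition perfect_covering (m : nat) (S : 'I_m -> set int) (c : nat) : Prop :=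
  forall x : int, (\sum_(k < m) (x \in S k : nat))%N = c.

(* Only the binary digits of index i < n can be nonzero, since n < 2 ^ n. *)
Definition binary_ones (n : nat) : nat := (\sum_(i < n) odd (n %/ 2 ^ i))%N.

(* Main.v *)
(* Modulo [q], an integer [x] lies in the [k]-th Beatty set iff the residue of
   [u 2^j - 1/2] is less than that of [delta 2^j], where [u = delta (gamma - x)]
   and [j = m - k].  For residues [w, d], [q] times the truth value of [w < d]
   is [d - w + ((w - d) mod q)], so [q] times the number of sets containing [x]
   is the sum over [j < m] of
     (delta 2^j mod q) - (u 2^j - 1/2 mod q) + ((u - delta) 2^j - 1/2 mod q).
   Each doubling orbit closes up after [m] steps, whence the sum of the residues
   of [u 2^j] is [q] times the number of carries [u 2^j mod q > q/2], and the sum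
   of the residues of [u 2^j - 1/2] does not depend on [u].  What remains is the
   number of carries in the orbit of [delta], which are the binary digits of
   [delta (2^m - 1) / q]. *)

Require Import Defs.
From mathcomp Require Import all_boot all_order all_fingroup all_algebra.
From mathcomp Require Import boolp classical_sets.
From mathcomp Require Import zify ring.

Set Implicit Arguments.
Unset Strict Implicit.
Unset Printing Implicit Defensive.

Import Order.TTheory GRing.Theory Num.Theory.

Local Open Scope ring_scope.

(** The floor is [x] iff [n * q] lies in [[p (x - r), p (x - r) + p)], and the first multiple of [q]
    from [p (x - r)] on is at distance [- p (x - r) mod q]. *)
Lemma mem_beatty (q p r x : int) : 0 < p -> 0 < q ->
  (x \in beatty q p r) = ((- (p * (x - r)) %% q)%Z < p).
Proof.
move=> p_gt0 q_gt0; have pQ_gt0 : (0 : rat) < p%:~R by rewrite ltr0z.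
have beattyE (n : int) :
    (Num.floor ((n * q)%:~R / p%:~R + r%:~R : rat) = x) <->
    (p * (x - r) <= n * q < p * (x - r) + p).
  have -> : (p * (x - r) <= n * q < p * (x - r) + p) =
      (x%:~R <= ((n * q)%:~R / p%:~R + r%:~R : rat) < (x + 1)%:~R).
    rewrite -lerBlDr -ltrBrDr ler_pdivlMr // ltr_pdivrMr //.
    rewrite -!intrB -!intrM ler_int ltr_int.
    by congr (_ && _); congr (_ _ _); ring.
  by split=> [<-|/floor_def//]; rewrite floor_le floorD1_gt.
apply/idP/idP => [/set_mem [n _ /beattyE /andP[ge_n lt_n]]|lt_p].
  have -> : - (p * (x - r)) = (- n) * q + (n * q - p * (x - r)) by ring.
  rewrite modzMDl; apply: le_lt_trans (_ : n * q - p * (x - r) < p); last lia.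
  set e := _ - _; have e_ge0 : 0 <= e by rewrite /e; lia.
  have := divz_eq e q; have : 0 <= (e %/ q)%Z by rewrite divz_ge0.
  nia.
apply/mem_set; exists (- (- (p * (x - r)) %/ q)%Z) => //; apply/beattyE.
have := divz_eq (- (p * (x - r))) q.
have : 0 <= (- (p * (x - r)) %% q)%Z by rewrite modz_ge0 ?gt_eqF.
lia.
Qed.

Lemma modz_small2 (q t : int) : 0 <= t < 2 * q ->
  (t %% q)%Z = t - q * (q <= t)%R%:R.
Proof.
move=> t_bnd; have [le_qt|lt_tq] := leP q t.
  by rewrite -(modzMDl (-1)) modz_small; lia.
by rewrite mulr0 subr0 modz_small; lia.
Qed.

(** As [- q < w - d < q], the residue of [w - d] is [w - d], plus [q] exactly when [w < d]. *)
Lemma ltz_modz (q w d : int) : 0 <= w < q -> 0 <= d < q ->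
  q * (w < d)%R%:R = d - w + ((w - d) %% q)%Z.
Proof.
move=> w_bnd d_bnd; rewrite -(modzMDl 1) mul1r modz_small2; last lia.
by have [|] := ltP w d; have [|] := leP q (q + (w - d)) => /=; lia.
Qed.

Section DoublingOrbit.

Variables (q : int) (m : nat).
Hypotheses (q_gt0 : 0 < q) (exp2m : (2 ^+ m = 1 %[mod q])%Z).

Let residue_bnd (t : int) : 0 <= (t %% q)%Z < q.
Proof. by rewrite modz_ge0 ?gt_eqF // ltz_pmod. Qed.

(** The residues satisfy [2 t_j - t_(j+1) = q * carry_j]; over a closed orbit the left sides add up
    to the sum of the [t_j]. *)
Lemma sum_residue_carry (u : int) :
  \sum_(j < m) (u * 2 ^+ j %% q)%Z =
  q * \sum_(j < m) (q <= 2 * (u * 2 ^+ j %% q)%Z)%R%:R.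
Proof.
pose t (j : nat) := (u * 2 ^+ j %% q)%Z.
have tS j : q * (q <= 2 * t j)%R%:R = 2 * t j - t j.+1.
  have := residue_bnd (u * 2 ^+ j); rewrite -/(t j) => t_bnd.
  have -> : t j.+1 = (2 * t j %% q)%Z by rewrite /t modzMmr exprS mulrCA.
  by rewrite modz_small2; lia.
have tm : t m = t 0%N by rewrite /t -modzMmr exp2m modzMmr expr0.
have shift : \sum_(j < m) t j.+1 = \sum_(j < m) t j.
  apply: (@addrI _ (t 0%N)).
  by rewrite -(big_ord_recl m (fun j => t j)) big_ord_recr /= tm addrC.
rewrite mulr_sumr (eq_bigr _ (fun (j : 'I_m) _ => tS j)) [RHS]sumrB shift.
by rewrite -mulr_sumr mulrDl mul1r addrK.
Qed.

(* As [q = 2 n + 1], adding [n] amounts to subtracting 1/2 modulo [q]. *)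
Lemma sum_residue_half (n u : int) : q = 2 * n + 1 ->
  \sum_(j < m) ((u * 2 ^+ j + n) %% q)%Z = n *+ m.
Proof.
move=> def_q; have modD j : ((u * 2 ^+ j + n) %% q)%Z =
    (u * 2 ^+ j %% q)%Z + n - q * (q <= 2 * (u * 2 ^+ j %% q)%Z)%R%:R.
  rewrite -modzDml; have := residue_bnd (u * 2 ^+ j).
  set t := (_ %% _)%Z => t_bnd; rewrite modz_small2; last lia.
  by congr (_ - q * (_ : bool)%:R); lia.
rewrite (eq_bigr _ (fun (j : 'I_m) _ => modD j)) sumrB big_split /=.
by rewrite sum_residue_carry mulr_sumr sumr_const card_ord addrAC subrr add0r.
Qed.

Lemma sum_ltz_residue (n u d : int) : q = 2 * n + 1 ->
  (\sum_(j < m) (((u * 2 ^+ j + n) %% q)%Z < (d * 2 ^+ j %% q)%Z)%R =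
   \sum_(j < m) (q <= 2 * (d * 2 ^+ j %% q)%Z)%R)%N.
Proof.
move=> def_q; apply/eqP; rewrite -(eqr_nat int) !natr_sum; apply/eqP.
apply: (@mulfI _ q); first by rewrite gt_eqF.
rewrite -sum_residue_carry mulr_sumr.
transitivity (\sum_(j < m) ((d * 2 ^+ j %% q)%Z - ((u * 2 ^+ j + n) %% q)%Z
    + (((u - d) * 2 ^+ j + n) %% q)%Z)).
  apply: eq_bigr => j _; rewrite ltz_modz //; congr (_ + _).
  by rewrite modzDml -modzDmr modzNm modzDmr; congr (_ %% _)%Z; ring.
(* The half-shifted sums for [u] and [u - d] both equal [n *+ m] and cancel. *)
by rewrite big_split sumrB /= !sum_residue_half // subrK.
Qed.

End DoublingOrbit.

Lemma binary_ones_trunc (N m : nat) : (N < 2 ^ m)%N ->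
  binary_ones N = (\sum_(i < m) odd (N %/ 2 ^ i))%N.
Proof.
have trunc a b : (N < 2 ^ a)%N -> (a <= b)%N ->
    (\sum_(i < b) odd (N %/ 2 ^ i) = \sum_(i < a) odd (N %/ 2 ^ i))%N.
  move=> N_lt le_ab; rewrite -!(big_mkord xpredT (fun i => odd (N %/ 2 ^ i) : nat)).
  rewrite [LHS](@big_cat_nat _ _ _ a) //= [X in (_ + X)%N = _]big_nat_cond.
  rewrite [X in (_ + X)%N = _]big1 ?addn0 // => i /andP[/andP[le_ai _] _].
  by rewrite divn_small // (leq_trans N_lt) // leq_exp2l.
move=> N_lt; rewrite /binary_ones.
by case: (leqP m N) => [/trunc->|/ltnW/trunc->] //; apply: ltn_expl.
Qed.

(** [a * 2 %/ q] is twice [a %/ q] plus the carry of doubling [a %% q]. *)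
Lemma odd_double_divn (q a : nat) : (0 < q)%N ->
  odd (a * 2 %/ q) = (q <= 2 * (a %% q))%N.
Proof.
move=> q_gt0; rewrite {1}(divn_eq a q).
have -> : ((a %/ q * q + a %% q) * 2 = a %/ q * 2 * q + 2 * (a %% q))%N by ring.
rewrite divnMDl // oddD oddM andbF /=.
have := ltn_pmod a q_gt0; set t := (a %% q)%N => t_lt.
have [le_q|lt_q] := leqP q (2 * t); last by rewrite divn_small.
have -> : (2 * t = 1 * q + (2 * t - q))%N by lia.
by rewrite divnMDl // divn_small //; lia.
Qed.

(** Binary long division: as [d < q], the quotient is [d * 2 ^ m %/ q], whose digit [i] is the
    parity of [d * 2 ^ (m - i) %/ q], the carry of doubling step [m - i - 1]. *)
Lemma binary_ones_carry (q m d : nat) : (0 < d < q)%N -> 2 ^ m = 1 %[mod q] ->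
  binary_ones (d * (2 ^ m - 1) %/ q) =
  (\sum_(j < m) (q <= 2 * (d * 2 ^ j %% q)))%N.
Proof.
move=> /andP[d_gt0 d_lt] exp2m; have q_gt0 : (0 < q)%N by lia.
have q_dvd : (q %| 2 ^ m - 1)%N by rewrite -eqn_mod_dvd ?expn_gt0 //; apply/eqP.
have -> : (d * (2 ^ m - 1) %/ q = d * 2 ^ m %/ q)%N.
  have -> : (d * 2 ^ m = d * (2 ^ m - 1) + d)%N.
    by have := expn_gt0 2 m; nia.
  by rewrite divnDl ?dvdn_mull // (divn_small d_lt) addn0.
rewrite (@binary_ones_trunc _ m); last first.
  by rewrite ltn_divLR // mulnC ltn_pmul2l // expn_gt0.
rewrite [RHS](reindex_inj rev_ord_inj) /=; apply: eq_bigr => i _.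
rewrite -odd_double_divn // -mulnA -expnSr subnSK // -divnMA.
have -> : (2 ^ m = 2 ^ (m - i) * 2 ^ i)%N by rewrite -expnD subnK // ltnW.
by rewrite mulnA divnMr // expn_gt0.
Qed.

(* [m.-primitive_root x] is MathComp's "m is the least positive integer with
   x ^+ m = 1", i.e., m is the multiplicative order of x.
   Indices are 0-based: k : 'I_m stands for the index k + 1 of 1, ..., m.
   In the count of ones, delta is taken as its residue in [0, q): the
   hypotheses only determine delta modulo q, whereas the number of ones of
   delta (2 ^ m - 1) / q depends on the chosen representative. *)
Theorem theorem4p2 (q m : nat) (p r : 'I_m -> int)
    (s : 'S_m) (delta deltabar gamma : int) :
  (3 <= q)%N -> (3 <= m)%N ->
  (forall k : 'I_m, 0 < p k < q%:Z) ->
  odd q ->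
  m.-primitive_root (2%:R : 'Z_q) ->
  coprimez delta q%:Z ->
  (delta * deltabar = 1 %[mod q%:Z])%Z ->
  (forall k : 'I_m,
     (p (s k) = delta * 2 ^+ (m - k.+1) %[mod q%:Z])%Z /\
     (r (s k) = gamma - deltabar * 2 ^+ k %[mod q%:Z])%Z) ->
  perfect_covering (fun k : 'I_m => beatty q%:Z (p k) (r k))
    (binary_ones ((`|(delta %% q%:Z)%Z| * (2 ^ m - 1)) %/ q)%N).
Proof.
move=> q_ge3 _ p_bnd q_odd prim2 _ deltaK pr x.
have q_gt0 : 0 < q%:Z by lia.
have exp2m : 2 ^ m = 1 %[mod q].
  have q_gt1 : (1 < q)%N by apply: leq_trans q_ge3.
  have : (2 ^ m)%:R = 1%:R :> 'Z_q by rewrite natrX (prim_expr_order prim2).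
  by move/(congr1 (@nat_of_ord _)); rewrite !val_Zp_nat.
have exp2E j : 2 ^+ j = (2 ^ j)%N :> int by rewrite -natz natrX.
have exp2mz : (2 ^+ m = 1 %[mod q%:Z])%Z.
  by rewrite exp2E !modz_nat exp2m.
set d := `|(delta %% q%:Z)%Z|%N.
have dE : d%:Z = (delta %% q%:Z)%Z by rewrite gez0_abs // modz_ge0 // gt_eqF.
have d_bnd : (0 < d < q)%N.
  rewrite -[(d < q)%N]ltz_nat dE ltz_pmod // andbT lt0n.
  apply/eqP => d0; move: deltaK; rewrite -modzMml -dE d0 mul0r mod0z.
  by rewrite modz_small //; lia.
rewrite binary_ones_carry //.
pose n := q./2%:Z; have def_q : q%:Z = 2 * n + 1.
  by rewrite /n; have := odd_double_half q; rewrite q_odd; lia.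
transitivity (\sum_(j < m) (q%:Z <= 2 * (delta * 2 ^+ j %% q%:Z)%Z)%R)%N; last first.
  apply: eq_bigr => j _; congr (nat_of_bool _).
  by rewrite -modzMml -dE exp2E -PoszM modz_nat -PoszM lez_nat.
rewrite -(sum_ltz_residue q_gt0 exp2mz (delta * (gamma - x)) delta def_q).
rewrite (reindex_inj (@perm_inj _ s)) [RHS](reindex_inj rev_ord_inj) /=.
apply: eq_bigr => k _; congr (nat_of_bool _).
have [p_mod r_mod] := pr k.
have /andP[p_gt0 p_lt] := p_bnd (s k).
rewrite mem_beatty // -p_mod (modz_small (m := p (s k))); last lia.
(* With [P = 2 ^ (m - k - 1)] and [K = 2 ^ k], [- p (x - r)] is congruent to
   [delta (gamma - x) P - P K]; here [P K = 2 ^ (m - 1)] is an inverse of 2 modulo [q], as is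
   [- n]. *)
congr (_ < _); apply/eqP; rewrite eqz_mod_dvd.
have {}p_mod : (q%:Z %| p (s k) - delta * 2 ^+ (m - k.+1))%Z.
  by rewrite -eqz_mod_dvd; apply/eqP.
have {}r_mod : (q%:Z %| r (s k) - (gamma - deltabar * 2 ^+ k))%Z.
  by rewrite -eqz_mod_dvd; apply/eqP.
have {}deltaK : (q%:Z %| delta * deltabar - 1)%Z.
  by rewrite -eqz_mod_dvd; apply/eqP.
have {}exp2mz : (q%:Z %| 2 ^+ m - 1)%Z by rewrite -eqz_mod_dvd; apply/eqP.
have exp2 : 2 ^+ m = 2 * (2 ^+ (m - k.+1) * 2 ^+ k) :> int.
  by rewrite -exprD -exprS -addnS subnK.
move: p_mod r_mod deltaK exp2mz => /dvdzP[a Ea] /dvdzP[b Eb] /dvdzP[c Ec] /dvdzP[e].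
rewrite {}exp2; set P := 2 ^+ (m - k.+1); set K := 2 ^+ k => Ee.
have {Ea} -> : p (s k) = a * q%:Z + delta * P by rewrite -Ea subrK.
have {Eb} -> : r (s k) = b * q%:Z + (gamma - deltabar * K) by rewrite -Eb subrK.
have {}Ec : delta * deltabar = c * q%:Z + 1 by rewrite -Ec subrK.
(* Multiplying by [1 = q - 2 n] gives the quotient of [P K + n] by [q] from that of
   [2 (P K + n)]. *)
have PKn : P * K + n = (P * K + n - n * (e + 1)) * q%:Z.
  have {}Ee : 2 * (P * K + n) = (e + 1) * q%:Z.
    by rewrite mulrDr -[2 * (P * K)](subrK 1) Ee def_q; ring.
  by rewrite mulrBl -[n * _ * _]mulrA -Ee def_q; ring.
apply/dvdzP; exists (delta * P * b - a * (x - b * q%:Z - gamma + deltabar * K)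
  - c * (P * K) - (P * K + n - n * (e + 1))).
rewrite [RHS]mulrBl -PKn.
transitivity ((delta * P * b - a * (x - b * q%:Z - gamma + deltabar * K)) * q%:Z
  - delta * deltabar * (P * K) - n); first by ring.
by rewrite Ec; ring.
Qed.
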